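(* Let $n\ge 1$ and let $\mathbb{F}_q$ be a finite field. The regular character of $U(n,\mathbb{F}_q)$ is equal to the sum $$\sum_{\Psi}\frac{|\Psi|}{\deg\chi(\Psi)}\cdot\chi(\Psi)$$ over the collection of coadjoint clusters $\Psi$ in $\mathfrak{u}^*(n,\mathbb{F}_q)$.
   Context: $U(n,\mathbb{F}_q)$ is the group of upper triangular unipotent $n\times n$ matrices over $\mathbb{F}_q$, $\mathfrak{u}(n,\mathbb{F}_q)$ is the algebra of upper triangular nilpotent (strictly upper triangular) matrices, and $\mathfrak{u}^*(n,\mathbb{F}_q)$ is its $\mathbb{F}_q$-linear dual. For $g\in U(n,\mathbb{F}_q)$ and $\lambda\in\mathfrak{u}^*(n,\mathbb{F}_q)$ define $(g*\lambda)(X)=\lambda(Xg)$ (left action) and $(\lambda*g)(X)=\lambda(gX)$ (right action); these commute. The coadjoint cluster of $\lambda$ is $\Psi(\lambda)=\{g*\lambda*g' : g,g'\in U(n,\mathbb{F}_q)\}$. Fix a non-trivial homomorphism $\theta$ from the additive group of $\mathbb{F}_q$ to the multiplicative group $\mathbb{C}^\times$. Let $\mathbb{C}[U(n,\mathbb{F}_q)]$ be the space of complex-valued functions on $U(n,\mathbb{F}_q)$, carrying the regular representation $(g*v)(g')=v(g'g)$, and put $v(\lambda)(g)=\theta[\lambda(g-I)]$. For $\lambda\in\mathfrak{u}^*(n,\mathbb{F}_q)$, the span $V(\lambda)$ of $\{v(\mu): \mu=g*\lambda,\ g\in U(n,\mathbb{F}_q)\}$ is a submodule of the regular representation, called a cluster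 module; its character $\chi(\lambda)$ is called a cluster character. It depends only on the coadjoint cluster $\Psi$ of $\lambda$, and one writes $\chi(\Psi)=\chi(\lambda)$. $\deg\chi(\Psi)=\chi(\Psi)(I)$ is its degree. *)

(* Defs.v *)
From HB Require Import structures.
From mathcomp Require Import all_boot all_order all_algebra.
From mathcomp Require Import all_fingroup all_field all_character.

Set Implicit Arguments.
Unset Strict Implicit.
Unset Printing Implicit Defensive.

Import GRing.Theory.
Local Open Scope ring_scope.

(* All matrices have size n.+1, so that n >= 0 covers every size >= 1. *)

Section Unitriangular.
Variables (F : finFieldType) (n : nat).

Definition unitri : pred 'M[F]_n.+1 :=
  fun A => [forall i : 'I_n.+1, forall j : 'I_n.+1,
               (j <= i)%N ==> (A i j == (i == j)%:R)].

Lemma unitriP (A : 'M[F]_n.+1) :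
  reflect (forall i j : 'I_n.+1, (j <= i)%N -> A i j = (i == j)%:R) (unitri A).
Proof.
apply: (iffP forallP) => [H i j lji | H i].
  by have /forallP/(_ j)/implyP/(_ lji)/eqP := H i.
by apply/forallP=> j; apply/implyP=> /H/eqP.
Qed.

Definition Uset : {set {'GL_n.+1[F]}} := [set g : {'GL_n.+1[F]} | unitri (GLval g)].

Lemma Uset_group_set : group_set Uset.
Proof.
apply/group_setP; split=> [|x y].
  by rewrite inE; apply/unitriP => i j _; rewrite GL_1E mxE.
rewrite !inE => /unitriP Hx /unitriP Hy; apply/unitriP => i j lji.
rewrite GL_ME mxE (bigD1 i) //= Hx // eqxx mul1r big1 ?addr0; first exact: Hy.
move=> k neki; have [lki | lik] := leqP k i.
  by rewrite Hx // eq_sym (negPf neki) mul0r.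
have ljk : (j < k)%N by apply: leq_ltn_trans lik.
by rewrite (Hy k j) ?(ltnW ljk) // -val_eqE /= gtn_eqF // mulr0.
Qed.
Canonical Ugroup := Group Uset_group_set.

(* U(n.+1, F), as a finite group type. *)
Definition UT := subg_of Ugroup.
HB.instance Definition _ := Finite.on UT.
HB.instance Definition _ := FinGroup.on UT.

Definition umat (g : UT) : 'M[F]_n.+1 := GLval (sgval g).

Lemma umat1 : umat 1%g = 1%:M. Proof. by []. Qed.

Lemma umatM (g h : UT) : umat (g * h)%g = umat g *m umat h. Proof. by []. Qed.

Lemma umatP (g : UT) (i j : 'I_n.+1) :
  (j <= i)%N -> umat g i j = (i == j)%:R.
Proof. by have := subgP g; rewrite inE => /unitriP; apply. Qed.

(* The strictly upper triangular matrices. *)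
Definition nilu : {vspace 'M[F]_n.+1} :=
  (\sum_(p : 'I_n.+1 * 'I_n.+1 | (p.1 < p.2)%N) <[delta_mx p.1 p.2]>)%VS.

Lemma niluP (X : 'M[F]_n.+1) :
  reflect (forall i j : 'I_n.+1, (j <= i)%N -> X i j = 0) (X \in nilu).
Proof.
apply: (iffP idP) => [/memv_sumP[Y YP ->] i j lji | X0].
  rewrite summxE big1 // => p ltp; have /vlineP[c ->] := YP p ltp.
  rewrite !mxE; case: eqP => [ip|_] /=; last by rewrite mulr0.
  case: eqP => [jp|_] /=; last by rewrite mulr0.
  by move: ltp; rewrite -ip -jp ltnNge lji.
rewrite (matrix_sum_delta X) pair_big /= memv_suml // => -[i j] _ /=.
have [lji | lij] := leqP j i; first by rewrite X0 // scale0r mem0v.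
apply: memvZ; apply: subvP (memv_line (delta_mx i j)).
by apply: (sumv_sup (i, j)).
Qed.

Lemma nilu_mulr (X : 'M[F]_n.+1) (g : UT) : X \in nilu -> X *m umat g \in nilu.
Proof.
move/niluP=> X0; apply/niluP => i j lji; rewrite mxE big1 // => k _.
have [lki | lik] := leqP k i; first by rewrite X0 ?mul0r.
have ljk : (j < k)%N by apply: leq_ltn_trans lik.
by rewrite umatP ?(ltnW ljk) // -val_eqE /= gtn_eqF ?mulr0.
Qed.

Lemma nilu_mull (X : 'M[F]_n.+1) (g : UT) : X \in nilu -> umat g *m X \in nilu.
Proof.
move/niluP=> X0; apply/niluP => i j lji; rewrite mxE big1 // => k _.
have [lki | lik] := ltnP k i.
  by rewrite umatP ?(ltnW lki) // -val_eqE /= gtn_eqF ?mul0r.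
by rewrite X0 ?mulr0 // (leq_trans lji).
Qed.

Lemma nilu_subr1 (g : UT) : umat g - 1%:M \in nilu.
Proof. by apply/niluP => i j lji; rewrite !mxE umatP ?subrr. Qed.

(* The linear dual of nilu; finvect_type only makes it a finite type. *)
Definition dual := finvect_type 'Hom(subvs_of nilu, F^o).
HB.instance Definition _ := Finite.on dual.
HB.instance Definition _ := Vector.on dual.

(* Value of a linear form at a matrix X (meant for X \in nilu). *)
Definition dapp (l : dual) (X : 'M[F]_n.+1) : F :=
  (l : 'Hom(subvs_of nilu, F^o)) (vsproj nilu X).

Lemma dapp_is_linear (l : dual) : linear (dapp l : 'M[F]_n.+1 -> F^o).
Proof. by move=> a X Y; rewrite /dapp !linearP. Qed.
HB.instance Definition _ (l : dual) :=
  GRing.isLinear.Build F 'M[F]_n.+1 F^o *:%R (dapp l : _ -> F^o)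
    (dapp_is_linear l).

(* (g * l)(X) = l(X g) and (l * g)(X) = l(g X). *)
Definition lact (g : UT) (l : dual) : dual :=
  linfun (fun X : subvs_of nilu => dapp l (vsval X *m umat g) : F^o).

Definition ract (l : dual) (g : UT) : dual :=
  linfun (fun X : subvs_of nilu => dapp l (umat g *m vsval X) : F^o).

Lemma lactE (g : UT) (l : dual) (X : 'M[F]_n.+1) :
  X \in nilu -> dapp (lact g l) X = dapp l (X *m umat g).
Proof.
move=> uX; rewrite {1}/dapp /lact.
pose f (Y : subvs_of nilu) : F^o := dapp l (vsval Y *m umat g).
have f_lin : linear f.
  by move=> a Y Z; rewrite /f linearP /= mulmxDl -scalemxAl (dapp_is_linear l).
pose fL := GRing.isLinear.Build _ _ _ _ f f_lin.
pose ff : {linear subvs_of nilu -> F^o} := HB.pack f fL.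
by rewrite (lfunE ff) /= /f vsprojK.
Qed.

Lemma ractE (g : UT) (l : dual) (X : 'M[F]_n.+1) :
  X \in nilu -> dapp (ract l g) X = dapp l (umat g *m X).
Proof.
move=> uX; rewrite {1}/dapp /ract.
pose f (Y : subvs_of nilu) : F^o := dapp l (umat g *m vsval Y).
have f_lin : linear f.
  by move=> a Y Z; rewrite /f [vsval _]linearP mulmxDr -scalemxAr (dapp_is_linear l).
pose fL := GRing.isLinear.Build _ _ _ _ f f_lin.
pose ff : {linear subvs_of nilu -> F^o} := HB.pack f fL.
by rewrite (lfunE ff) /= /f vsprojK.
Qed.

Lemma dappP (l m : dual) : {in nilu, dapp l =1 dapp m} -> l = m.
Proof.
move=> lm; apply/lfunP => X; have := lm _ (subvsP X).
by rewrite /dapp vsvalK.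
Qed.

Lemma lact_ract (g h : UT) (l : dual) :
  lact g (ract l h) = ract (lact g l) h.
Proof.
apply: dappP => X uX.
by rewrite lactE // ractE ?nilu_mulr // ractE // lactE ?nilu_mull // mulmxA.
Qed.

Lemma lactM (g h : UT) (l : dual) : lact g (lact h l) = lact (g * h)%g l.
Proof.
by apply: dappP => X uX; rewrite !lactE ?nilu_mulr // umatM mulmxA.
Qed.

Lemma ractM (g h : UT) (l : dual) : ract (ract l g) h = ract l (g * h)%g.
Proof.
by apply: dappP => X uX; rewrite !ractE ?nilu_mull // umatM mulmxA.
Qed.

Lemma lact1 (l : dual) : lact 1%g l = l.
Proof. by apply: dappP => X uX; rewrite lactE // umat1 mulmx1. Qed.

Lemma ract1 (l : dual) : ract l 1%g = l.
Proof. by apply: dappP => X uX; rewrite ractE // umat1 mul1mx. Qed.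

Definition cluster (l : dual) : {set dual} :=
  [set ract (lact g l) g' | g : UT, g' : UT].

Definition clusters : {set {set dual}} := [set cluster l | l : dual].

Section Modules.
(* C plays the role of the complex numbers; R[i] is an instance. *)
Variable C : numClosedFieldType.

Definition funU := {ffun UT -> C^o}.
HB.instance Definition _ := Vector.on funU.

(* The regular representation: (g * v)(g') = v(g' g). *)
Definition rtrans (g : UT) (v : funU) : funU := [ffun g' => v (g' * g)%g].

Lemma rtrans_is_linear g : linear (rtrans g).
Proof. by move=> a v w; apply/ffunP => h; rewrite !ffunE. Qed.
HB.instance Definition _ g :=
  GRing.isLinear.Build C funU funU *:%R (rtrans g) (rtrans_is_linear g).

Definition submodule (V : {vspace funU}) : Prop :=
  forall g v, v \in V -> rtrans g v \in V.

(* The matrix of the action of g on V, in a basis of V.  The matrices act on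
   columns, so that they multiply in the same order as group elements. *)
Definition submodule_mx (V : {vspace funU}) (g : UT) : 'M[C]_(\dim V) :=
  \matrix_(i, j) coord (vbasis V) i (rtrans g (vbasis V)`_j).

Definition modchar (V : {vspace funU}) (g : UT) : C := \tr (submodule_mx V g).

Lemma submodule_mx_repr (V : {vspace funU}) :
  submodule V -> mx_repr [set: UT] (submodule_mx V).
Proof.
move=> Vsub; split=> [|g h _ _].
  apply/matrixP => i j; rewrite !mxE.
  suff -> : rtrans 1%g (vbasis V)`_j = (vbasis V)`_j.
    by rewrite coord_free ?(basis_free (vbasisP V)) // eq_sym.
  by apply/ffunP => k; rewrite ffunE mulg1.
apply/matrixP => i j; rewrite !mxE.
have -> : rtrans (g * h)%g (vbasis V)`_j = rtrans g (rtrans h (vbasis V)`_j).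
  by apply/ffunP => k; rewrite !ffunE mulgA.
have Vj : rtrans h (vbasis V)`_j \in V.
  by apply/Vsub/vbasis_mem/mem_nth; rewrite size_tuple.
rewrite {1}(coord_vbasis Vj) !linear_sum; apply: eq_bigr => k _.
by rewrite !mxE !linearZ /= mulrC.
Qed.

Definition ltrans (g : UT) (v : funU) : funU := [ffun g' => v (g * g')%g].

Lemma ltrans_is_linear g : linear (ltrans g).
Proof. by move=> a v w; apply/ffunP => h; rewrite !ffunE. Qed.
HB.instance Definition _ g :=
  GRing.isLinear.Build C funU funU *:%R (ltrans g) (ltrans_is_linear g).

Lemma ltransK g : cancel (ltrans g) (ltrans g^-1%g).
Proof. by move=> v; apply/ffunP => h; rewrite !ffunE mulKVg. Qed.

Lemma modchar_ltrans (V W : {vspace funU}) h :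
    submodule V ->
    {in V, forall v, ltrans h v \in W} ->
    {in W, forall w, ltrans h^-1%g w \in V} ->
  modchar V =1 modchar W.
Proof.
move=> Vsub VW WV g; rewrite /modchar.
have bV k : (k < \dim V)%N -> (vbasis V)`_k \in V.
  by move=> ?; apply/vbasis_mem/mem_nth; rewrite size_tuple.
have bW k : (k < \dim W)%N -> (vbasis W)`_k \in W.
  by move=> ?; apply/vbasis_mem/mem_nth; rewrite size_tuple.
pose P := \matrix_(i < \dim W, j < \dim V)
  coord (vbasis W) i (ltrans h (vbasis V)`_j).
pose Q := \matrix_(i < \dim V, j < \dim W)
  coord (vbasis V) i (rtrans g (ltrans h^-1%g (vbasis W)`_j)).
have -> : submodule_mx V g = Q *m P.
  apply/matrixP => i j; rewrite !mxE.
  rewrite -[X in rtrans g X](ltransK h) (coord_vbasis (VW _ (bV _ _))) //.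
  rewrite !linear_sum; apply: eq_bigr => k _.
  by rewrite !mxE !linearZ /= mulrC.
rewrite mxtrace_mulC; congr (\tr _); apply/matrixP => i j; rewrite !mxE.
have Vj : rtrans g (ltrans h^-1%g (vbasis W)`_j) \in V by apply/Vsub/WV/bW.
have -> : rtrans g (vbasis W)`_j =
    ltrans h (rtrans g (ltrans h^-1%g (vbasis W)`_j)).
  by apply/ffunP => k; rewrite !ffunE mulgA mulKg.
rewrite (coord_vbasis Vj) !linear_sum; apply: eq_bigr => k _.
by rewrite !mxE !linearZ /= mulrC.
Qed.

Definition regular_char : UT -> C := modchar fullv.

Section Clusters.
Variable theta : F -> C.

Definition vfun (l : dual) : funU :=
  [ffun g => theta (dapp l (umat g - 1%:M))].

Definition cluster_module (l : dual) : {vspace funU} :=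
  <<[seq vfun (lact g l) | g : UT]>>%VS.

Lemma cluster_module_submodule (l : dual) :
  {morph theta : x y / x + y >-> x * y} -> submodule (cluster_module l).
Proof.
move=> thD g v Vv.
suff: (linfun (rtrans g) @: cluster_module l <= cluster_module l)%VS.
  by move/subvP/(_ _ (memv_img (linfun (rtrans g)) Vv)); rewrite lfunE.
rewrite limg_span; apply/span_subvP => _ /mapP[_ /imageP[h _ ->] ->].
rewrite lfunE /=.
suff -> : rtrans g (vfun (lact h l)) =
    theta (dapp (lact h l) (umat g - 1%:M)) *: vfun (lact (g * h)%g l).
  by apply/memvZ/memv_span/imageP; exists (g * h)%g.
apply/ffunP => k; rewrite !ffunE -[_ *: _]/(_ * _) -thD.
congr (theta _); rewrite !lactE ?nilu_subr1 //.
rewrite -[RHS](raddfD (dapp l)); congr (dapp l _).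
by rewrite !umatM !mulmxBl !mul1mx mulmxA [RHS]addrC subrKA.
Qed.

Lemma cluster_module_lact (l : dual) (g : UT) :
  cluster_module (lact g l) = cluster_module l.
Proof.
apply/eqP; rewrite eqEsubv; apply/andP; split; apply: sub_span.
  by move=> _ /imageP[h _ ->]; apply/imageP; exists (h * g)%g; rewrite ?lactM.
move=> _ /imageP[h _ ->]; apply/imageP; exists (h * g^-1)%g => //.
by rewrite lactM mulgKV.
Qed.

Lemma cluster_module_ract (l : dual) (g : UT) v :
    {morph theta : x y / x + y >-> x * y} ->
  v \in cluster_module l -> ltrans g v \in cluster_module (ract l g).
Proof.
move=> thD Vv.
suff: (linfun (ltrans g) @: cluster_module l <= cluster_module (ract l g))%VS.
  by move/subvP/(_ _ (memv_img (linfun (ltrans g)) Vv)); rewrite lfunE.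
rewrite limg_span; apply/span_subvP => _ /mapP[_ /imageP[h _ ->] ->].
rewrite lfunE /=.
suff -> : ltrans g (vfun (lact h l)) =
    theta (dapp (lact h l) (umat g - 1%:M)) *: vfun (lact h (ract l g)).
  by apply/memvZ/memv_span/imageP; exists h.
apply/ffunP => k; rewrite !ffunE -[_ *: _]/(_ * _) -thD lact_ract.
congr (theta _); rewrite (ractE g) ?nilu_subr1 //.
rewrite -[RHS](raddfD (dapp (lact h l))); congr (dapp _ _).
by rewrite umatM mulmxBr mulmx1 [RHS]addrC subrKA.
Qed.

Definition cluster_char (Psi : {set dual}) : UT -> C :=
  modchar (cluster_module (odflt 0 [pick l in Psi])).

(* chi(Psi) does not depend on the form picked in Psi. *)
Lemma cluster_char_cluster (l : dual) :
    {morph theta : x y / x + y >-> x * y} ->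
  cluster_char (cluster l) =1 modchar (cluster_module l).
Proof.
move=> thD x; rewrite /cluster_char; case: pickP => [m | /(_ l)] /=; last first.
  case/negP; apply/imset2P; exists (1%g : UT) (1%g : UT) => //.
  by rewrite lact1 ract1.
case/imset2P => g g' _ _ ->; rewrite -lact_ract cluster_module_lact.
apply/esym/(modchar_ltrans (h := g')); first exact: cluster_module_submodule.
  by move=> v; apply: cluster_module_ract.
move=> v Vv; rewrite -[l]ract1 -(mulgV g') -ractM.
exact: cluster_module_ract.
Qed.

Definition cluster_deg (Psi : {set dual}) : C := cluster_char Psi 1%g.

End Clusters.
End Modules.
End Unitriangular.

Arguments clusters F n : clear implicits.
Arguments UT F n : clear implicits.
Arguments regular_char F n C g : clear implicits.

(* Main.v *)
From HB Require Import structures.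
Require Import Defs.
From mathcomp Require Import all_boot all_order all_algebra.
From mathcomp Require Import all_fingroup all_field all_character.

Set Implicit Arguments.
Unset Strict Implicit.
Unset Printing Implicit Defensive.

Import GRing.Theory Num.Theory.
Local Open Scope ring_scope.

(** For a form l, the function v(l) : g |-> theta (l (g - 1)) is a character of
    the additive group of strictly upper triangular matrices, transported to U
    by g |-> g - 1.  As l runs over the dual, these are all the characters, so
    the v(l) form a basis of C[U]; both halves of this are orthogonality
    relations ([sum_theta_group], which gives the coordinate forms [coef], and
    [sum_theta_dual], which gives the spanning property [vspanT]).

    In this basis the regular representation is monomial: g sends v(l) to
    theta (l (g - 1)) v(g * l) ([rtrans_vfun]).  So only the l fixed by g
    contribute to its trace, each with the weight theta (l (g - 1)).  This
    gives the regular character as the sum of [fixed_weight g] over the whole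
    dual ([regular_char_fixed_weight]), and the character of V(l), which is
    spanned by the v(m) for m in the left orbit of l, as the sum of the same
    weights over that orbit; in particular deg chi is the size of the orbit.

    A cluster Psi is a disjoint union of left orbits, and chi(Psi) is the
    character of V(l) for every l in Psi.  Hence |Psi| / deg chi(Psi) * chi(Psi)
    is the sum over l in Psi of the average of the weights over the left orbit
    of l.  Averaging over the blocks of a partition preserves the total
    ([sum_lorbit_average]), so this is the sum of the weights over Psi, and the
    clusters partition the dual. *)

(** * Vanishing of character sums *)

(** Reindexing the sum by s multiplies it by c.  This is the usual reason why a
    non-trivial character sums to zero; with an arbitrary injection s it also
    applies to U, where the relevant s is a translation of g - 1 and not of g. *)
Lemma sum_eq0_semiinvariant (R : idomainType) (I : finType) (f : I -> R)
    (s : I -> I) (c : R) :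
    injective s -> c != 1 -> (forall i, f (s i) = c * f i) ->
  \sum_i f i = 0.
Proof.
move=> s_inj c_neq1 fs; apply/eqP.
have: \sum_i f i = c * \sum_i f i.
  by rewrite [LHS](reindex_inj s_inj) mulr_sumr; apply: eq_bigr => i _.
move/eqP; rewrite -subr_eq0 -{1}[\sum_i f i]mul1r -mulrBl mulf_eq0.
by rewrite subr_eq0 eq_sym (negPf c_neq1).
Qed.

(** * Strictly upper triangular matrices and their dual *)

Section Unitriangular.
Variables (F : finFieldType) (n : nat).
Implicit Types (l m : dual F n) (g h : UT F n).

Lemma umat_inj : injective (@umat F n).
Proof. by move=> g h eq_gh; apply: val_inj; apply: val_inj. Qed.

Lemma umat_surj (X : 'M[F]_n.+1) :
  X \in nilu F n -> exists g : UT F n, umat g = 1%:M + X.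
Proof.
move=> /niluP X0.
have unitriX : unitri (1%:M + X).
  by apply/unitriP => i j lji; rewrite !mxE X0 ?addr0.
have uX : 1%:M + X \in unitmx.
  rewrite unitmxE -det_tr det_trig.
    rewrite big1 ?unitr1 // => i _.
    by rewrite mxE (unitriP _ unitriX) ?eqxx.
  apply/is_trig_mxP => i j lij; rewrite mxE.
  by rewrite (unitriP _ unitriX _ _ (ltnW lij)) -val_eqE /= gtn_eqF.
pose g : {'GL_n.+1[F]} := FinRing.unit _ uX.
have gU : g \in Ugroup F n by rewrite inE.
by exists (Subg gU).
Qed.

(** The translations of the additive group of strictly upper triangular
    matrices, read on U through the bijection g |-> g - 1. *)
Lemma nilu_translation (X : 'M[F]_n.+1) : X \in nilu F n ->
  {s : UT F n -> UT F n |
    injective s & forall g, umat (s g) - 1%:M = X + (umat g - 1%:M)}.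
Proof.
move=> uX.
have ex g : exists h : UT F n, umat h == 1%:M + (X + (umat g - 1%:M)).
  have [|h hE] := @umat_surj (X + (umat g - 1%:M)); last by exists h; apply/eqP.
  by rewrite memvD ?nilu_subr1.
have sE g := eqP (xchooseP (ex g)).
exists (fun g => xchoose (ex g)); last by move=> g; rewrite sE addrC addKr.
move=> g h eq_gh; apply/umat_inj.
by have := sE g; rewrite eq_gh sE => /addrI/addrI/addIr.
Qed.

Lemma dappD l m X : dapp (l + m) X = dapp l X + dapp m X.
Proof. by rewrite /dapp add_lfunE. Qed.

Lemma dappB l m X : dapp (l - m) X = dapp l X - dapp m X.
Proof. by apply/eqP; rewrite eq_sym subr_eq -dappD subrK. Qed.

Lemma dappZl (a : F) l X : dapp (a *: l) X = a * dapp l X.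
Proof. by rewrite /dapp scale_lfunE. Qed.

Lemma dappZr l (a : F) X : dapp l (a *: X) = a * dapp l X.
Proof. by rewrite /dapp !linearZ. Qed.

Lemma dual_neq0 l : l != 0 -> exists2 X, X \in nilu F n & dapp l X = 1.
Proof.
move=> l_neq0.
suff /existsP[X /andP[uX lX]] : [exists X in nilu F n, dapp l X != 0].
  exists ((dapp l X)^-1 *: X); first exact: memvZ.
  by rewrite dappZr mulVf.
apply: contraNT l_neq0 => /existsPn H; apply/eqP/dappP => X uX.
have := H X; rewrite uX negbK => /eqP->.
by rewrite /dapp zero_lfunE.
Qed.

(** A rescaled matrix coefficient is such a form. *)
Lemma dual_separates X :
  X \in nilu F n -> X != 0 -> exists l, dapp l X = 1.
Proof.
move=> uX /matrix0Pn[i [j Xij_neq0]].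
pose f (Y : subvs_of (nilu F n)) : F^o := (X i j)^-1 * vsval Y i j.
have f_lin : linear f.
  by move=> a Y Z; rewrite /f linearP !mxE mulrDr mulrCA.
pose fL := GRing.isLinear.Build _ _ _ _ f f_lin.
pose ff : {linear subvs_of (nilu F n) -> F^o} := HB.pack f fL.
exists (linfun ff); rewrite /dapp lfunE /= /f vsprojK //.
exact: mulVf.
Qed.

(** * Traces of submodules *)

Section Modules.
Variable C : numClosedFieldType.

(** For T the action of g on V, the hypothesis writes the identity of V as the
    sum of the rank one maps v |-> c_i (v) e_i, hence T = id o T as the sum of
    the maps v |-> c_i (T v) e_i, whose traces are the c_i (T e_i).  The e_i
    need not be known to be independent, and no basis of V adapted to them has
    to be chosen. *)
Lemma modchar_frame (V : {vspace funU F n C}) (I : finType)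
    (A : {pred I}) (e : I -> funU F n C) (c : I -> {scalar funU F n C}) :
    submodule V -> {in A, forall i, e i \in V} ->
    {in V, forall v, v = \sum_(i in A) c i v *: e i} ->
  forall g, modchar V g = \sum_(i in A) c i (rtrans g (e i)).
Proof.
move=> Vsub eV Vc g.
have bV k : (k < \dim V)%N -> (vbasis V)`_k \in V.
  by move=> ?; apply/vbasis_mem/mem_nth; rewrite size_tuple.
transitivity (\sum_(i in A) \sum_(k < \dim V)
    c i (rtrans g (vbasis V)`_k) * coord (vbasis V) k (e i)).
  rewrite exchange_big; apply: eq_bigr => k _; rewrite mxE.
  rewrite {1}(Vc _ (Vsub g _ (bV k _))) // linear_sum.
  by apply: eq_bigr => i _; rewrite linearZ.
apply: eq_bigr => i Ai; rewrite [in RHS](coord_vbasis (eV i Ai)) !linear_sum.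
by apply: eq_bigr => k _; rewrite !linearZ mulrC.
Qed.

(** * The basis of functions v(l) *)

Section Characters.
Variable theta : F -> C.
Hypothesis theta_neq0 : forall x : F, theta x != 0.
Hypothesis thetaD : forall x y : F, theta (x + y) = theta x * theta y.
Hypothesis theta_nontrivial : exists x : F, theta x != 1.

Lemma theta0 : theta 0 = 1.
Proof. by apply: (mulIf (theta_neq0 0)); rewrite -thetaD addr0 mul1r. Qed.

(** Orthogonality of the v(l): for l != 0, translating by a multiple a X with
    l X = 1 and theta a != 1 multiplies the sum by theta a. *)
Lemma sum_theta_group l :
  \sum_g theta (dapp l (umat g - 1%:M)) = (l == 0)%:R * #|UT F n|%:R.
Proof.
have [-> | l_neq0] := eqVneq l 0.
  under eq_bigr => g _ do rewrite /dapp zero_lfunE theta0.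
  by rewrite sumr_const mul1r.
have [X uX lX] := dual_neq0 l_neq0; have [a theta_a] := theta_nontrivial.
have [|s s_inj sE] := @nilu_translation (a *: X); first exact: memvZ.
rewrite mul0r; apply: (sum_eq0_semiinvariant s_inj theta_a) => g.
by rewrite sE linearD /= dappZr lX mulr1 thetaD.
Qed.

(** Dual orthogonality: for X != 0, translating by a multiple of a form l with
    l X = 1 multiplies the sum by some theta a != 1. *)
Lemma sum_theta_dual X : X \in nilu F n ->
  \sum_l theta (dapp l X) = (X == 0)%:R * #|dual F n|%:R.
Proof.
move=> uX; have [-> | X_neq0] := eqVneq X 0.
  under eq_bigr => l _ do rewrite linear0 theta0.
  by rewrite sumr_const mul1r.
have [l lX] := dual_separates uX X_neq0; have [a theta_a] := theta_nontrivial.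
rewrite mul0r.
apply: (sum_eq0_semiinvariant (addrI (a *: l)) theta_a) => m.
by rewrite dappD dappZl lX mulr1 thetaD.
Qed.

(** The Fourier coefficient of v at l.  Inverting theta by a sign in its
    argument replaces complex conjugation. *)
Definition coef l (v : funU F n C) : C :=
  #|UT F n|%:R^-1 * \sum_g theta (- dapp l (umat g - 1%:M)) * v g.

Lemma coef_is_scalar l : scalar (coef l).
Proof.
move=> a v w; rewrite /coef mulrCA -mulrDr; congr (_ * _).
rewrite mulr_sumr -big_split; apply: eq_bigr => g _ /=.
by rewrite !ffunE mulrDr mulrCA.
Qed.
HB.instance Definition _ l :=
  GRing.isLinear.Build C (funU F n C) C *%R (coef l) (coef_is_scalar l).

Lemma card_UT_neq0 : #|UT F n|%:R != 0 :> C.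
Proof. by rewrite pnatr_eq0 -lt0n; apply/card_gt0P; exists 1%g. Qed.

Lemma coef_vfun l m : coef l (vfun theta m) = (l == m)%:R.
Proof.
rewrite /coef; under eq_bigr => g _ do
  rewrite ffunE -thetaD addrC -dappB.
rewrite sum_theta_group subr_eq0 eq_sym mulrC mulfK //.
exact: card_UT_neq0.
Qed.

Definition vspan (A : {set dual F n}) : {vspace funU F n C} :=
  <<[seq vfun theta l | l in A]>>%VS.

Lemma vspan_coef A : {in vspan A, forall v,
  v = \sum_(l in A) coef l v *: vfun theta l}.
Proof.
move=> v; rewrite /vspan span_def big_image => /memv_sumP[Y Yline ->].
apply: eq_bigr => l Al; have /vlineP[a Yl] := Yline l Al.
rewrite linear_sum (bigD1 l) //= Yl linearZ /= coef_vfun eqxx mulr1.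
rewrite big1 ?addr0 // => m /andP[Am m_neq_l].
have /vlineP[b ->] := Yline m Am.
by rewrite linearZ /= coef_vfun eq_sym (negPf m_neq_l) mulr0.
Qed.

(** Multiplicativity of theta, applied to h g - 1 = (h - 1) g + (g - 1). *)
Lemma rtrans_vfun g l :
  rtrans g (vfun theta l) =
    theta (dapp l (umat g - 1%:M)) *: vfun theta (lact g l).
Proof.
apply/ffunP => k; rewrite !ffunE -[_ *: _]/(_ * _) -thetaD.
congr (theta _); rewrite lactE ?nilu_subr1 //.
rewrite -[RHS](raddfD (dapp l)); congr (dapp l _).
by rewrite umatM !mulmxBl !mul1mx [RHS]addrC subrKA.
Qed.

Lemma modchar_vspan A g : submodule (vspan A) ->
  modchar (vspan A) g =
    \sum_(l in A | lact g l == l) theta (dapp l (umat g - 1%:M)).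
Proof.
move=> subA; rewrite (modchar_frame subA _ (@vspan_coef A)); last first.
  by move=> l Al; apply/memv_span/imageP; exists l.
rewrite big_mkcondr; apply: eq_bigr => l _ /=.
rewrite rtrans_vfun linearZ /= coef_vfun eq_sym.
by case: eqP; rewrite ?mulr1 ?mulr0.
Qed.

(** Fourier inversion: by dual orthogonality, the delta function at h is a
    multiple of the sum of the theta (- l (h - 1)) v(l). *)
Lemma vspanT : vspan setT = fullv.
Proof.
apply/vspaceP => v; rewrite [RHS]memvf.
have -> : v = \sum_h v h *: [ffun k => (h == k)%:R] :> funU F n C.
  apply/ffunP => k; rewrite sum_ffunE (bigD1 k) //= !ffunE eqxx.
  rewrite big1 => [|h /negPf h_neq_k]; first by rewrite addr0 [RHS]mulr1.
  by rewrite !ffunE h_neq_k [LHS]mulr0.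
apply: memv_suml => h _; apply: memvZ.
have -> : [ffun k => (h == k)%:R] = #|dual F n|%:R^-1 *:
    \sum_l theta (- dapp l (umat h - 1%:M)) *: vfun theta l :> funU F n C.
  apply/ffunP => k; rewrite !ffunE sum_ffunE.
  under eq_bigr => l _ do rewrite !ffunE -[_ *: _]/(_ * _) -thetaD addrC
    -(raddfB (dapp l)) opprB addrA subrK.
  rewrite sum_theta_dual; last first.
    rewrite (_ : _ - _ = (umat k - 1%:M) - (umat h - 1%:M)).
      by rewrite memvB ?nilu_subr1.
    by rewrite opprB addrA subrK.
  rewrite subr_eq0 (inj_eq umat_inj) eq_sym -[_ *: _]/(_ * _) mulrC mulfK //.
  by rewrite pnatr_eq0 -lt0n; apply/card_gt0P; exists 0.
apply/memvZ/memv_suml => l _; apply/memvZ/memv_span/imageP.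
by exists l; rewrite ?inE.
Qed.

(** * Left orbits and clusters *)

Definition lorbit l : {set dual F n} := [set lact g l | g : UT F n].

Lemma lorbit_refl l : l \in lorbit l.
Proof. by apply/imsetP; exists 1%g; rewrite ?lact1. Qed.

Lemma mem_lorbit l m : (m \in lorbit l) = (lorbit l == lorbit m).
Proof.
apply/idP/eqP => [|->]; last exact: lorbit_refl.
case/imsetP => g _ ->; apply/setP => k; apply/imsetP/imsetP => -[h _ ->].
  by exists (h * g^-1)%g; rewrite // lactM mulgKV.
by exists (h * g)%g; rewrite // lactM.
Qed.

Lemma mem_cluster l m : (m \in cluster l) = (cluster l == cluster m).
Proof.
apply/idP/eqP => [|->]; last first.
  by apply/imset2P; exists (1%g : UT F n) (1%g : UT F n); rewrite ?lact1 ?ract1.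
case/imset2P => g g' _ _ ->; apply/setP => k.
apply/imset2P/imset2P => -[h h' _ _ ->].
  exists (h * g^-1)%g (g'^-1 * h')%g => //.
  by rewrite lact_ract lactM mulgKV ractM mulKVg.
by exists (h * g)%g (g' * h')%g; rewrite // lact_ract lactM ractM.
Qed.

Lemma lorbit_sub_cluster l m : m \in lorbit l -> m \in cluster l.
Proof.
case/imsetP => g _ ->; apply/imset2P.
by exists g (1%g : UT F n); rewrite ?ract1.
Qed.

Lemma cluster_module_vspan l : cluster_module theta l = vspan (lorbit l).
Proof.
apply: eq_span => v; apply/imageP/imageP => [[g _ ->]|[m /imsetP[g _ ->] ->]].
  by exists (lact g l) => //; apply: imset_f.
by exists g.
Qed.

(** After exchanging the sums, f m occurs with the weight 1 / |lorbit l| for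
    each l in Psi whose left orbit contains m.  These l are the |lorbit m|
    elements of the left orbit of m, so the total weight of f m is 1. *)
Lemma sum_lorbit_average (Psi : {set dual F n}) (f : dual F n -> C) :
    (forall l m, l \in Psi -> m \in lorbit l -> m \in Psi) ->
  \sum_(l in Psi) #|lorbit l|%:R^-1 * (\sum_(m in lorbit l) f m) =
    \sum_(m in Psi) f m.
Proof.
move=> PsiS; under eq_bigr => l _ do rewrite mulr_sumr.
rewrite (exchange_big_dep (mem Psi)) //=; apply: eq_bigr => m Psi_m.
transitivity (\sum_(l in lorbit m) #|lorbit m|%:R^-1 * f m).
  apply: eq_big => [l|l /andP[_]]; last by rewrite mem_lorbit => /eqP->.
  rewrite !mem_lorbit eq_sym andb_idl // -mem_lorbit.
  exact: PsiS.
rewrite sumr_const -[LHS]mulr_natl mulrA mulfV ?mul1r //.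
rewrite pnatr_eq0 -lt0n; apply/card_gt0P; exists m; exact: lorbit_refl.
Qed.

(** * Characters as sums of weights *)

(** The diagonal coefficient of the action of g at the basis vector v(m). *)
Definition fixed_weight g m : C :=
  if lact g m == m then theta (dapp m (umat g - 1%:M)) else 0.

Lemma modchar_cluster_module l g :
  modchar (cluster_module theta l) g = \sum_(m in lorbit l) fixed_weight g m.
Proof.
have := @cluster_module_submodule F n C theta l thetaD.
by rewrite cluster_module_vspan => /modchar_vspan->; rewrite big_mkcondr.
Qed.

Lemma cluster_char_lorbit Psi l g : Psi \in clusters F n -> l \in Psi ->
  cluster_char theta Psi g = \sum_(m in lorbit l) fixed_weight g m.
Proof.
case/imsetP => k _ ->; rewrite mem_cluster => /eqP->.
by rewrite cluster_char_cluster // modchar_cluster_module.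
Qed.

Lemma fixed_weight1 l : fixed_weight 1%g l = 1.
Proof. by rewrite /fixed_weight lact1 eqxx umat1 subrr linear0 theta0. Qed.

Lemma cluster_deg_lorbit Psi l : Psi \in clusters F n -> l \in Psi ->
  cluster_deg theta Psi = #|lorbit l|%:R.
Proof.
move=> PsiC Psi_l; rewrite /cluster_deg (cluster_char_lorbit _ PsiC Psi_l).
by under eq_bigr => m _ do rewrite fixed_weight1; rewrite sumr_const.
Qed.

(** Both |lorbit l| and the sum over lorbit l are independent of l in Psi, so
    multiplying their quotient by |Psi| amounts to summing it over Psi. *)
Lemma cluster_summand Psi g : Psi \in clusters F n ->
  #|Psi|%:R / cluster_deg theta Psi * cluster_char theta Psi g =
    \sum_(m in Psi) fixed_weight g m.
Proof.
move=> PsiC; rewrite -(sum_lorbit_average (Psi := Psi)); last first.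
  case/imsetP: PsiC => k _ -> l m; rewrite !mem_cluster => /eqP->.
  by move/lorbit_sub_cluster; rewrite mem_cluster.
rewrite -mulrA mulr_natl -sumr_const; apply: eq_bigr => l Psi_l.
by rewrite (cluster_deg_lorbit PsiC Psi_l) (cluster_char_lorbit _ PsiC Psi_l).
Qed.

Lemma regular_char_fixed_weight g :
  regular_char F n C g = \sum_m fixed_weight g m.
Proof.
rewrite /regular_char -vspanT modchar_vspan; last first.
  by rewrite vspanT => h v _; rewrite memvf.
by rewrite big_mkcondr; apply: eq_bigl => m; rewrite inE.
Qed.

End Characters.
End Modules.
End Unitriangular.

Theorem theorem2p4 (F : finFieldType) (n : nat) (C : numClosedFieldType)
    (theta : F -> C)
    (theta_neq0 : forall x : F, theta x != 0)
    (thetaD : forall x y : F, theta (x + y) = theta x * theta y)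
    (theta_nontrivial : exists x : F, theta x != 1)
    (g : UT F n) :
  regular_char F n C g =
    \sum_(Psi in clusters F n)
      #|Psi|%:R / cluster_deg theta Psi * cluster_char theta Psi g.
Proof.
rewrite (regular_char_fixed_weight theta_neq0 thetaD theta_nontrivial).
rewrite (partition_big (@cluster F n) (mem (clusters F n))); last first.
  by move=> l _; apply: imset_f.
apply: eq_bigr => Psi PsiC; rewrite cluster_summand //.
apply: eq_bigl => l; case/imsetP: PsiC => k _ ->.
by rewrite mem_cluster eq_sym.
Qed.
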